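(* Let $K\ge1$ be an integer, $t>0$, $\lambda\in(0,1]$, $\eta\in[0,1]$. Let $P_{XV}$ be a joint probability distribution of a pair of views $(X,V)$ taking values in $\mathcal{X}\times\mathcal{X}$, with marginals $P_X$ and $P_V$, and let the noisy joint distribution be $$P^\eta_{XV}=(1-\eta)P_{XV}+\eta P_XP_V,$$ where $P_XP_V$ is the product of the marginals. Let $\phi:\mathcal{X}\to\mathbb{R}^d$ be an encoder and $f:\mathbb{R}^d\to\mathbb{R}^m$ a projection head that is Lipschitz with Lipschitz constant $\mathrm{Lip}(f)$ with respect to Euclidean norms and projects to the unit hypersphere (i.e. $\|f(z)\|=1$ for all $z$). If $$\lambda\ge\frac{\eta K-\eta+1}{\eta K-\eta+1+K},$$ then $$-\mathbb{E}_{P^\eta_{XV}}\left[\mathcal{L}^{\lambda,q=1}_{\mathrm{RINCE}}(\mathbf{s})\right]\le(1-\eta)\cdot L\cdot I_{\mathcal{W}}(\phi(X),\phi(V)),\qquad L=\frac{\mathrm{Lip}(f)\cdot(1-\lambda)\cdot e^{1/t}}{t},$$ where the expectation is over $(x,v)\sim P^\eta_{XV}$ and $v_1,\dots,v_K\sim P_V$ drawn independently of each other and of $(x,v)$; $\mathbf{s}=(s^+,s_1^-,\dots,s_K^-)$ with $s^+=f(\phi(x))^Tf(\phi(v))/t$ and $s_i^-=f(\phi(x))^Tf(\phi(v_i))/t$; and $I_{\mathcal{W}}(\phi(X),\phi(V))$ is the Wasserstein dependency measure of the noise-free distribution $P_{XV}$.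
   Context: For $\mathbf{s}=(s^+,s_1^-,\dots,s_K^-)\in\mathbb{R}^{K+1}$, $q,\lambda\in(0,1]$, $$\mathcal{L}^{\lambda,q}_{\mathrm{RINCE}}(\mathbf{s})=\frac{-e^{q s^+}}{q}+\frac{\left(\lambda\left(e^{s^+}+\sum_{i=1}^K e^{s_i^-}\right)\right)^q}{q};$$ in particular for $q=1$ it equals $-(1-\lambda)e^{s^+}+\lambda\sum_{i=1}^K e^{s_i^-}$. $P^\phi_{XV}$ denotes the law of $(\phi(X),\phi(V))$ on $\mathbb{R}^d\times\mathbb{R}^d$ for $(X,V)\sim P_{XV}$; $P^\phi_X P^\phi_V$ denotes the product of the pushforwards $\phi_\#P_X$ and $\phi_\#P_V$. The maps are measurable. For probability measures $\mu,\nu$ on $\mathbb{R}^d\times\mathbb{R}^d$, $$\mathcal{W}(\mu,\nu)=\inf_{\pi\in\Pi(\mu,\nu)}\mathbb{E}_{((X,V),(X',V'))\sim\pi}\left[\|X-X'\|+\|V-V'\|\right],$$ where $\Pi(\mu,\nu)$ is the set of couplings of $\mu$ and $\nu$ and $\|\cdot\|$ is the Euclidean norm (the value $+\infty$ is allowed, with the convention $0\cdot\infty=0$). The Wasserstein dependency measure is $$I_{\mathcal{W}}(\phi(X),\phi(V))=\mathcal{W}\left(P^\phi_{XV},P^\phi_XP^\phi_V\right).$$ *)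

(* Defs.v *)
From HB Require Import structures.
From mathcomp Require Import all_boot all_order all_algebra.
From mathcomp Require Import all_classical all_reals all_analysis.

Set Implicit Arguments.
Unset Strict Implicit.
Unset Printing Implicit Defensive.

Import Order.TTheory GRing.Theory Num.Theory.
Import numFieldNormedType.Exports.

Local Open Scope classical_set_scope.
Local Open Scope ring_scope.

(* R^n is 'rV[R]_n with its Borel sigma-algebra. The library norm on 'rV[R]_n
   is the sup norm; it induces the Euclidean topology, but the norms below are
   Euclidean. *)
HB.instance Definition _ (R : realType) (n : nat) :=
  Measurable.copy 'rV[R]_n (g_sigma_algebraType (@open 'rV[R]_n)).

Definition dotv (R : realType) (n : nat) (x y : 'rV[R]_n) : R :=
  \sum_(i < n) x 0 i * y 0 i.

Definition enorm (R : realType) (n : nat) (x : 'rV[R]_n) : R :=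
  Num.sqrt (dotv x x).

Section lipschitz.
Context (R : realType) (n m : nat).
Implicit Type f : 'rV[R]_n -> 'rV[R]_m.

Definition lipschitz_bound f (k : R) : Prop :=
  0 <= k /\ forall x y, enorm (f x - f y) <= k * enorm (x - y).

Definition elipschitz f : Prop := exists k, lipschitz_bound f k.

(* The least Lipschitz constant; meaningful when [elipschitz f]. *)
Definition Lip f : R := inf [set k | lipschitz_bound f k].

End lipschitz.

Section measurable_maps.
Context d1 d2 d3 d4 (T1 : measurableType d1) (T2 : measurableType d2)
  (T3 : measurableType d3) (T4 : measurableType d4).

HB.instance Definition _ :=
  isMeasurableFun.Build _ _ _ _ (@fst T1 T2) measurable_fst.
HB.instance Definition _ :=
  isMeasurableFun.Build _ _ _ _ (@snd T1 T2) measurable_snd.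

Definition map_pair (f : T1 -> T3) (g : T2 -> T4) (w : T1 * T2) : T3 * T4 :=
  (f w.1, g w.2).

Lemma measurable_map_pair (f : {mfun T1 >-> T3}) (g : {mfun T2 >-> T4}) :
  measurable_fun setT (map_pair f g).
Proof.
by apply: measurable_fun_pair; apply: measurableT_comp.
Qed.

HB.instance Definition _ (f : {mfun T1 >-> T3}) (g : {mfun T2 >-> T4}) :=
  isMeasurableFun.Build _ _ _ _ (map_pair f g) (measurable_map_pair f g).

End measurable_maps.

Section cons_tuple.
Context d (T : measurableType d) (n : nat).

Definition cons_pair (w : T * n.-tuple T) : n.+1.-tuple T :=
  [tuple of w.1 :: w.2].

Lemma measurable_cons_pair : measurable_fun setT cons_pair.
Proof.
apply/measurable_fun_tnthP => i.
case: (unliftP ord0 i) => [j ->|->].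
  rewrite (_ : _ \o _ = (@tnth _ T ^~ j) \o snd); last first.
    by apply/funext => w /=; rewrite tnthS.
  by apply: measurableT_comp => //; exact: measurable_tnth.
by rewrite (_ : _ \o _ = fst).
Qed.

HB.instance Definition _ :=
  isMeasurableFun.Build _ _ _ _ cons_pair measurable_cons_pair.

End cons_tuple.

(* The n-fold product measure, i.e. the law of n independent draws from P. *)
Fixpoint iid_law d (T : measurableType d) (R : realType)
    (P : probability T R) (n : nat) : probability (n.-tuple T) R :=
  if n is n'.+1 then distribution (P \x iid_law P n')%E (@cons_pair _ T n')
  else \d_([tuple] : 0.-tuple T).

Section mixture.
Context d (T : measurableType d) (R : realType).
Variables (P Q : probability T R) (eta : R).

(* The unused argument makes the mixture canonically a probability. *)
Definition mixture of 0 <= eta <= 1 := fun A : set T =>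
  ((1 - eta)%:E * P A + eta%:E * Q A)%E.

Hypothesis eta01 : 0 <= eta <= 1.

Let eta_ge0 : 0 <= eta. Proof. by case/andP: eta01. Qed.
Let onem_eta_ge0 : 0 <= 1 - eta.
Proof. by rewrite subr_ge0; case/andP: eta01. Qed.

Let mixtureE :
  mixture eta01 = measure_add (mscale (NngNum onem_eta_ge0) P)
                              (mscale (NngNum eta_ge0) Q).
Proof. by apply/funext => A; rewrite measure_addE. Qed.

Let mixture0 : mixture eta01 set0 = 0%E.
Proof. by rewrite mixtureE /measure_add measure0. Qed.

Let mixture_ge0 A : (0 <= mixture eta01 A)%E.
Proof. by rewrite mixtureE /measure_add measure_ge0. Qed.

Let mixture_sigma_additive : semi_sigma_additive (mixture eta01).
Proof. by rewrite mixtureE /measure_add; exact: measure_semi_sigma_additive. Qed.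

HB.instance Definition _ := isMeasure.Build _ _ _ (mixture eta01)
  mixture0 mixture_ge0 mixture_sigma_additive.

Let mixture_setT : mixture eta01 setT = 1%E.
Proof.
by rewrite /mixture !probability_setT !mule1 -EFinD subrK.
Qed.

HB.instance Definition _ := Measure_isProbability.Build _ _ _ (mixture eta01)
  mixture_setT.

End mixture.

Section views.
Context d (X : measurableType d) (R : realType).
Variable P : probability (X * X)%type R.

Definition margX : probability X R := distribution P (@fst X X).

Definition margV : probability X R := distribution P (@snd X X).

Definition noisy_joint (eta : R) (eta01 : 0 <= eta <= 1) :
    probability (X * X)%type R :=
  mixture P (margX \x margV)%E eta01.

End views.

Section wasserstein.
Context (R : realType) (n : nat).
Local Notation E := 'rV[R]_n.
Local Notation E2 := (E * E)%type.

Definition coupling (mu nu : probability E2 R)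
    (pi : probability (E2 * E2)%type R) : Prop :=
  forall A : set E2, measurable A ->
    pi (fst @^-1` A) = mu A /\ pi (snd @^-1` A) = nu A.

Definition wasserstein (mu nu : probability E2 R) : \bar R :=
  ereal_inf [set (\int[pi]_z
      (enorm (z.1.1 - z.2.1) + enorm (z.1.2 - z.2.2))%:E)%E
    | pi in [set pi | coupling mu nu pi]].

Definition wasserstein_dependency d (X : measurableType d)
    (P : probability (X * X)%type R) (phi : {mfun X >-> E}) : \bar R :=
  wasserstein (distribution P (map_pair phi phi))
              (distribution (margX P) phi \x distribution (margV P) phi)%E.

End wasserstein.

Definition rince (R : realType) (K : nat) (lambda q : R)
    (sp : R) (sn : 'I_K -> R) : R :=
  - expR (q * sp) / q
  + (lambda * (expR sp + \sum_(i < K) expR (sn i))) `^ q / q.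

Section scores.
Context (R : realType) (X : Type) (n m : nat).
Variables (t : R) (phi : X -> 'rV[R]_n) (f : 'rV[R]_n -> 'rV[R]_m).

Definition score (x v : X) : R := dotv (f (phi x)) (f (phi v)) / t.

(* [w] is a sample ((x, v), (v_1, ..., v_K)). *)
Definition rince_sample (K : nat) (lambda q : R)
    (w : (X * X) * K.-tuple X) : R :=
  rince lambda q (score w.1.1 w.1.2) (fun i => score w.1.1 (tnth w.2 i)).

End scores.

(* Main.v *)
(** For q = 1 the loss is affine in the exponentiated scores, so its expectation
    only involves p = E_P[G] and r = E_{P_X P_V}[G], where
    G(x, v) = exp(f(phi x) . f(phi v) / t); the mixture contributes r with weight
    eta, and each of the K negatives contributes r.  The bound on lambda implies
    lambda (1 + K) >= 1, which makes -E[loss] <= (1 - lambda)(1 - eta)(p - r).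
    On the unit sphere G is Lipschitz with constant Lip(f) e^{1/t} / t for the
    cost ||x - x'|| + ||v - v'||, so the easy half of Kantorovich duality bounds
    p - r by that constant times the Wasserstein distance. *)

Require Import Defs.
From HB Require Import structures.
From mathcomp Require Import all_boot all_order all_algebra.
From mathcomp Require Import all_classical all_reals all_analysis.
From mathcomp Require Import measurable_realfun.
From mathcomp Require Import ring lra.
Import Order.TTheory GRing.Theory Num.Theory.
Import numFieldNormedType.Exports.
Local Open Scope classical_set_scope.
Local Open Scope ring_scope.

Set Implicit Arguments.
Unset Strict Implicit.
Unset Printing Implicit Defensive.

(** * Euclidean inner product and norm on row vectors *)

Section euclidean.
Context (R : realType) (n : nat).
Implicit Types x y z : 'rV[R]_n.

Lemma dotvC x y : dotv x y = dotv y x.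
Proof. by apply: eq_bigr => i _; rewrite mulrC. Qed.

Lemma dotvBl x y z : dotv (x - y) z = dotv x z - dotv y z.
Proof. by rewrite -sumrB; apply: eq_bigr => i _; rewrite !mxE mulrBl. Qed.

Lemma dotvBr x y z : dotv x (y - z) = dotv x y - dotv x z.
Proof. by rewrite dotvC dotvBl !(dotvC x). Qed.

Lemma dotvZl (a : R) x y : dotv (a *: x) y = a * dotv x y.
Proof. by rewrite mulr_sumr; apply: eq_bigr => i _; rewrite mxE mulrA. Qed.

Lemma dotvZr (a : R) x y : dotv x (a *: y) = a * dotv x y.
Proof. by rewrite dotvC dotvZl dotvC. Qed.

Lemma dotvv_ge0 x : 0 <= dotv x x.
Proof. by apply: sumr_ge0 => i _; rewrite -expr2 sqr_ge0. Qed.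

Lemma enorm_ge0 x : 0 <= enorm x.
Proof. exact: sqrtr_ge0. Qed.

Lemma dotv_eq1 x : enorm x = 1 -> dotv x x = 1.
Proof. by move=> x1; rewrite -[LHS]sqr_sqrtr ?dotvv_ge0// -/(enorm x) x1 expr1n. Qed.

(** Cauchy-Schwarz against a unit vector: expand the nonnegative squared norm of the residual
    [x - dotv x y *: y]. *)
Lemma dotv_le_enorm x y : enorm y = 1 -> `|dotv x y| <= enorm x.
Proof.
move=> /dotv_eq1 y1; rewrite -sqrtr_sqr ler_wsqrtr//.
have := dotvv_ge0 (x - dotv x y *: y).
rewrite !(dotvBl, dotvBr, dotvZl, dotvZr) (dotvC y x) y1; lra.
Qed.

Lemma le_coord_enorm x i : `|x 0 i| <= enorm x.
Proof.
rewrite -sqrtr_sqr ler_wsqrtr// /dotv (bigD1 i)//= expr2 lerDl.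
by apply: sumr_ge0 => j _; rewrite -expr2 sqr_ge0.
Qed.

(** Links the Euclidean norm to the sup norm that carries the topology. The crude constant [n],
    instead of its square root, is enough for continuity. *)
Lemma enorm_le_mx_norm x : enorm x <= n%:R * `|x|.
Proof.
rewrite -[leRHS]ger0_norm ?mulr_ge0// -sqrtr_sqr ler_wsqrtr//.
have le_coord i : x 0 i * x 0 i <= `|x| ^+ 2.
  rewrite -expr2 -real_normK ?num_real// ler_sqr ?nnegrE//.
  rewrite [leRHS](mx_normrE x).
  exact: (le_bigmax _ (fun ij => `|x ij.1 ij.2|) (0, i)).
apply: le_trans (ler_sum _ (fun i _ => le_coord i)) _.
rewrite sumr_const card_ord -[leLHS]mulr_natl exprMn ler_wpM2r ?sqr_ge0//.
by rewrite -natrX ler_nat; case: n => // k; rewrite expnS leq_pmulr.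
Qed.

End euclidean.

(** * The least Lipschitz constant, and continuity of Lipschitz maps *)

Section lipschitz.
Context (R : realType) (n m : nat) (f : 'rV[R]_n -> 'rV[R]_m).

Lemma Lip_ge0 : elipschitz f -> 0 <= Lip f.
Proof. by move=> [k fk]; apply: lb_le_inf; [exists k|move=> l []]. Qed.

Lemma Lip_bound x y : elipschitz f -> enorm (f x - f y) <= Lip f * enorm (x - y).
Proof.
move=> [k [k0 fk]]; have := enorm_ge0 (x - y).
(* At distance zero any admissible [k] makes the left side vanish. Otherwise every admissible
   constant dominates the difference quotient, hence so does their infimum. *)
rewrite le_eqVlt => /predU1P[xy0|xy_gt0].
  by rewrite (le_trans (fk x y))// -xy0 !mulr0.
rewrite -ler_pdivrMr//; apply: lb_le_inf; first by exists k.
by move=> l [_ fl]; rewrite ler_pdivrMr.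
Qed.

Lemma elipschitz_coord_continuous (i : 'I_m) :
  elipschitz f -> continuous (fun x => f x 0 i).
Proof.
move=> [k [k0 fk]] /= x A /nbhs_ballP[e /= e0 eA].
(* A sup distance [r] gives a Euclidean distance at most [n * r], whence the factor [k * n]; the
   [+ 1] keeps the divisor positive when this is zero. *)
have c0 : 0 < k * n%:R + 1 by rewrite ltr_wpDl// mulr_ge0.
apply/nbhs_ballP; exists (e / (k * n%:R + 1)); first exact: divr_gt0.
move=> y; rewrite -ball_normE /= ltr_pdivlMr// mulrC => xy.
apply: eA; apply: le_lt_trans xy.
have := le_coord_enorm (f x - f y) i; rewrite !mxE => /le_trans; apply.
apply: le_trans (fk x y) _.
rewrite mulrDl mul1r -mulrA ler_wpDr// ler_wpM2l//; exact: enorm_le_mx_norm.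
Qed.

End lipschitz.

(** * Borel measurability of maps built from row vectors *)

Lemma continuous_rV_measurable (R : realType) (n : nat) (g : 'rV[R]_n -> R) :
  continuous g -> measurable_fun setT g.
Proof.
move=> /continuousP cg.
apply: (measurability _ (RGenOpens.measurableE R)) => _ [_ [a [b ->] <-]].
by rewrite setTI; apply: sub_sigma_algebra; exact/cg/interval_open.
Qed.

Lemma measurable_fun_coord (R : realType) (n : nat) (i : 'I_n) :
  measurable_fun setT (fun x : 'rV[R]_n => x 0 i).
Proof. by apply: continuous_rV_measurable; exact: coord_continuous. Qed.

Lemma measurable_fun_enormB (d : measure_display) (T : measurableType d)
    (R : realType) (n : nat) (g h : T -> 'rV[R]_n) :
  measurable_fun setT g -> measurable_fun setT h ->
  measurable_fun setT (fun w => enorm (g w - h w)).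
Proof.
move=> mg mh.
have msqrt : measurable_fun setT (@Num.sqrt R).
  by apply: continuous_measurable_fun; exact: sqrt_continuous.
apply: (measurableT_comp msqrt).
apply: measurable_sum => i; under eq_fun do rewrite !mxE.
by apply: measurable_funM; apply: measurable_funB;
  apply: (measurableT_comp (measurable_fun_coord i)).
Qed.

Section draw.
Context (d : measure_display) (T : measurableType d) (n : nat) (i : 'I_n).

(** A named form of [tnth] to which a measurable-function structure can be attached, so that it can
    be fed to [map_pair]. *)
Definition draw (w : n.-tuple T) : T := tnth w i.

Let measurable_draw : measurable_fun setT draw.
Proof. exact: measurable_tnth. Qed.

HB.instance Definition _ :=
  isMeasurableFun.Build _ _ _ _ draw measurable_draw.

End draw.

(** * Laws of images, products, independent samples and mixtures *)

Section laws.
Context (R : realType).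
Local Open Scope ereal_scope.

(** Change of variables, with the law of [g] specified only on measurable sets: the form in which
    couplings and marginals are given. *)
Lemma ge0_integral_law (d1 d2 : measure_display) (T : measurableType d1)
    (U : measurableType d2) (P : probability T R) (Q : probability U R)
    (g : {mfun T >-> U}) (h : U -> \bar R) :
  (forall A, measurable A -> P (g @^-1` A) = Q A) ->
  measurable_fun setT h -> (forall y, 0 <= h y) ->
  \int[P]_x h (g x) = \int[Q]_y h y.
Proof.
move=> gPQ mh h0; rewrite -[LHS](ge0_integral_distribution (P := P) g mh h0).
by apply: eq_measure_integral => A mA _; exact: gPQ.
Qed.

(** The image law and the product agree on rectangles, and this determines a product measure. *)
Lemma product_law (d1 d2 d3 d4 : measure_display) (T1 : measurableType d1)
    (T2 : measurableType d2) (U1 : measurableType d3) (U2 : measurableType d4)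
    (P1 : probability T1 R) (P2 : probability T2 R)
    (Q1 : probability U1 R) (Q2 : probability U2 R)
    (g1 : {mfun T1 >-> U1}) (g2 : {mfun T2 >-> U2}) :
  (forall A, measurable A -> P1 (g1 @^-1` A) = Q1 A) ->
  (forall A, measurable A -> P2 (g2 @^-1` A) = Q2 A) ->
  forall A, measurable A -> (P1 \x P2) (map_pair g1 g2 @^-1` A) = (Q1 \x Q2) A.
Proof.
move=> g1E g2E A mA; apply/esym.
apply: (product_measure_unique (m' := distribution (P1 \x P2) (map_pair g1 g2)))
  => // B C mB mC.
suff: (P1 \x P2) ((g1 @^-1` B) `*` (g2 @^-1` C)) = Q1 B * Q2 C by [].
rewrite product_measure1E; try exact: measurable_funPTI.
by congr (_ * _); [exact: g1E|exact: g2E].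
Qed.

Lemma product_law_fst (d1 d2 : measure_display) (T1 : measurableType d1)
    (T2 : measurableType d2) (P1 : probability T1 R) (P2 : probability T2 R) A :
  measurable A -> (P1 \x P2) (fst @^-1` A) = P1 A.
Proof.
move=> mA; rewrite (_ : _ @^-1` _ = A `*` setT); last first.
  by apply/seteqP; split=> [[x y]|[x y] []].
by rewrite product_measure1E// -[RHS]mule1; congr (_ * _);
  exact: probability_setT.
Qed.

Lemma product_law_snd (d1 d2 : measure_display) (T1 : measurableType d1)
    (T2 : measurableType d2) (P1 : probability T1 R) (P2 : probability T2 R) A :
  measurable A -> (P1 \x P2) (snd @^-1` A) = P2 A.
Proof.
move=> mA; rewrite (_ : _ @^-1` _ = setT `*` A); last first.
  by apply/seteqP; split=> [[x y]|[x y] []].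
by rewrite product_measure1E// -[RHS]mul1e; congr (_ * _);
  exact: probability_setT.
Qed.

Lemma iid_law_draw (d : measure_display) (T : measurableType d)
    (P : probability T R) (n : nat) (i : 'I_n) (A : set T) :
  measurable A -> iid_law P n (draw i @^-1` A) = P A.
Proof.
elim: n i => [[]//|n IH] i mA.
rewrite [LHS]/= /distribution /pushforward/=.
case: (unliftP ord0 i) => [j ->|->].
  rewrite (_ : _ @^-1` _ = snd @^-1` (draw j @^-1` A)); last first.
    by apply/seteqP; split=> w; rewrite /draw/= tnthS.
  by rewrite [LHS]product_law_snd ?IH//; exact: measurable_funPTI.
by rewrite (_ : _ @^-1` _ = fst @^-1` A)// [LHS]product_law_fst.
Qed.

Lemma ge0_integral_mixture (d : measure_display) (T : measurableType d)
    (P Q : probability T R) (eta : R) (eta01 : (0 <= eta <= 1)%R)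
    (h : T -> \bar R) :
  measurable_fun setT h -> (forall x, 0 <= h x) ->
  \int[mixture P Q eta01]_x h x =
  (1 - eta)%:E * \int[P]_x h x + eta%:E * \int[Q]_x h x.
Proof.
move=> mh h0; have /andP[eta0 eta1] := eta01.
have eta'0 : (0 <= 1 - eta)%R by rewrite subr_ge0.
rewrite (eq_measure_integral (measure_add (mscale (NngNum eta'0) P)
  (mscale (NngNum eta0) Q))); last by move=> A _ _; exact/esym/measure_addE.
by rewrite ge0_integral_measure_add// !ge0_integral_mscale.
Qed.

(** Both components of the mixture have first marginal [margX P], so the noise does not affect the
    law of an anchor paired with a negative. *)
Lemma noisy_joint_fst (d : measure_display) (X : measurableType d)
    (P : probability (X * X)%type R) (eta : R) (eta01 : (0 <= eta <= 1)%R) A :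
  measurable A -> noisy_joint P eta01 (fst @^-1` A) = margX P A.
Proof.
move=> mA; have /andP[eta0 eta1] := eta01.
transitivity ((1 - eta)%:E * margX P A + eta%:E * margX P A); last first.
  by rewrite -ge0_muleDl ?lee_fin ?subr_ge0// -EFinD subrK mul1e.
by congr (_ + _ * _); exact: product_law_fst.
Qed.

End laws.

(** * The easy half of Kantorovich duality *)

Section kantorovich.
Context (R : realType) (n : nat).
Local Notation E := 'rV[R]_n.
Variables (mu nu : probability (E * E)%type R) (g : E * E -> R) (c : R).
Hypothesis mg : measurable_fun setT g.
Hypothesis g0 : forall z, 0 <= g z.
Hypothesis c0 : 0 <= c.
Hypothesis g_lip : forall z w,
  g z <= g w + c * (enorm (z.1 - w.1) + enorm (z.2 - w.2)).
Local Open Scope ereal_scope.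

Let cost (z : (E * E) * (E * E)) : R :=
  (enorm (z.1.1 - z.2.1) + enorm (z.1.2 - z.2.2))%R.

Let cost_ge0 z : (0 <= cost z)%R.
Proof. by rewrite addr_ge0// enorm_ge0. Qed.

Let measurable_cost : measurable_fun setT cost.
Proof.
by apply: measurable_funD; apply: measurable_fun_enormB;
  do 2 apply: measurableT_comp => //.
Qed.

(** Pull both integrals back to the coupling along its projections and integrate [g_lip]. Stated as
    a sum, it involves only nonnegative integrands, so no integrability is required. *)
Lemma coupling_bound pi : coupling mu nu pi ->
  \int[mu]_z (g z)%:E <= \int[nu]_z (g z)%:E + c%:E * \int[pi]_z (cost z)%:E.
Proof.
move=> pi_coupling.
have mgE : measurable_fun setT (EFin \o g) by exact/measurable_EFinP.
have gE0 z : 0 <= (EFin \o g) z by rewrite lee_fin.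
rewrite -[leLHS](@ge0_integral_law _ _ _ _ _ pi mu fst (EFin \o g))//;
  last by move=> A /pi_coupling[].
rewrite -[X in X + _](@ge0_integral_law _ _ _ _ _ pi nu snd (EFin \o g))//;
  last by move=> A /pi_coupling[].
have mcost : measurable_fun setT (EFin \o cost) by exact/measurable_EFinP.
have cost0 z : 0 <= (EFin \o cost) z by rewrite lee_fin.
rewrite -ge0_integralZl_EFin//; last by move=> z _; exact: cost0.
rewrite -ge0_integralD//; last 3 first.
- exact: measurableT_comp.
- by move=> z _; rewrite mule_ge0 ?lee_fin.
- exact: measurable_funeM.
apply: ge0_le_integral => //=.
- by move=> z _; rewrite lee_fin.
- exact: (measurableT_comp mgE).
- apply: emeasurable_funD; first exact: (measurableT_comp mgE).
  exact: measurable_funeM.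
- by move=> z _; rewrite -EFinM -EFinD lee_fin.
Qed.

Lemma wasserstein_dual : \int[nu]_z (g z)%:E \is a fin_num ->
  \int[mu]_z (g z)%:E <= \int[nu]_z (g z)%:E + c%:E * wasserstein mu nu.
Proof.
(* When [c = 0] the distance may be [+oo] and [0 * +oo = 0], so some coupling has
   to be exhibited: the product one. *)
move=> nu_fin; have := c0; rewrite le_eqVlt => /predU1P[c_eq0|c_gt0].
  have /coupling_bound : coupling mu nu (mu \x nu).
    by move=> A mA; split; [exact: product_law_fst|exact: product_law_snd].
  by rewrite -c_eq0 !mul0e.
(* Subtracting the finite [nu]-integral and dividing by [c > 0] turns the claim into a lower bound
   on the cost of each coupling. *)
rewrite -leeBlDl// -lee_pdivrMl//; apply: le_ereal_inf_tmp => _ [pi pi_coupling <-].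
by rewrite lee_pdivrMl// leeBlDl//; exact: coupling_bound.
Qed.

End kantorovich.

(** * The exponential similarity kernel on encoded pairs *)

Definition similarity (R : realType) (n m : nat) (f : 'rV[R]_n -> 'rV[R]_m)
  (t : R) (z : 'rV[R]_n * 'rV[R]_n) : R := expR (dotv (f z.1) (f z.2) / t).

Section similarity.
Context (R : realType) (n m : nat) (f : 'rV[R]_n -> 'rV[R]_m) (t : R).
Hypothesis t_gt0 : 0 < t.
Hypothesis f_lip : elipschitz f.
Hypothesis f_sphere : forall z, enorm (f z) = 1.

Lemma measurable_similarity : measurable_fun setT (similarity f t).
Proof.
apply: measurableT_comp => //; apply: measurable_funM => //.
apply: measurable_sum => i.
have mf : measurable_fun setT (fun x => f x 0 i).
  by apply: continuous_rV_measurable; exact: elipschitz_coord_continuous.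
by apply: measurable_funM; apply: (measurableT_comp mf).
Qed.

Lemma similarity_le z : similarity f t z <= expR (1 / t).
Proof.
rewrite ler_expR ler_pM2r ?invr_gt0//.
by rewrite (le_trans (ler_norm _))// (le_trans (dotv_le_enorm _ _))// f_sphere.
Qed.

Lemma similarity_lip z w : similarity f t z <= similarity f t w +
  Lip f * expR (1 / t) / t * (enorm (z.1 - w.1) + enorm (z.2 - w.2)).
Proof.
set a := dotv (f z.1) (f z.2); set b := dotv (f w.1) (f w.2).
have ab : a - b <= Lip f * (enorm (z.1 - w.1) + enorm (z.2 - w.2)).
  (* Change one argument at a time; in each term the other factor is a unit vector. *)
  have -> : a - b = dotv (f z.1 - f w.1) (f z.2) + dotv (f z.2 - f w.2) (f w.1).
    by rewrite !dotvBl /a /b (dotvC (f w.2)) (dotvC (f z.2)); ring.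
  rewrite mulrDr lerD// (le_trans (ler_norm _))//.
    by rewrite (le_trans (dotv_le_enorm _ (f_sphere _)))// Lip_bound.
  by rewrite (le_trans (dotv_le_enorm _ (f_sphere _)))// Lip_bound.
have Lip0 := Lip_ge0 f_lip.
set l := Lip f * _ in ab *.
have l0 : 0 <= l by rewrite mulr_ge0// addr_ge0// enorm_ge0.
(* Tangent-line inequality [1 + u <= expR u] at [u = (b - a) / t], scaled by [expR (a / t)]. *)
have expD : expR (a / t) - expR (b / t) <= expR (a / t) * ((a - b) / t).
  have -> : expR (b / t) = expR (a / t) * expR ((b - a) / t).
    by rewrite -expRD; congr expR; ring.
  rewrite -[X in X - _]mulr1 -mulrBr ler_wpM2l ?expR_ge0//.
  have := expR_ge1Dx ((b - a) / t); lra.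
have := similarity_le z; rewrite /similarity -/a -/b => az.
have -> : Lip f * expR (1 / t) / t * (enorm (z.1 - w.1) + enorm (z.2 - w.2)) =
  expR (1 / t) * (l / t) by rewrite /l; ring.
rewrite -lerBlDl (le_trans expD)//.
(* The order matters: [a - b] may be negative, so it is replaced by [l >= 0] before [expR (a / t)]
   is enlarged to [expR (1 / t)]. *)
apply: (@le_trans _ _ (expR (a / t) * (l / t))).
  by rewrite ler_wpM2l ?expR_ge0// ler_pM2r ?invr_gt0.
by rewrite ler_wpM2r// divr_ge0// ltW.
Qed.

End similarity.

(** * Integrability and the expected loss at [q = 1] *)

Lemma probability_bounded_integrable (d : measure_display)
    (T : measurableType d) (R : realType) (Q : probability T R) (h : T -> R)
    (M : R) :
  measurable_fun setT h -> (forall x, `|h x| <= M) ->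
  Q.-integrable setT (EFin \o h).
Proof.
move=> mh hM; apply: measurable_bounded_integrable => //.
  exact: (le_lt_trans (probability_le1 Q measurableT)) (ltry _).
exists M; split; first exact: num_real.
by move=> N /ltW MN x _ /=; exact: le_trans (hM x) MN.
Qed.

Section rince_expectation.
Context (R : realType) (dX : measure_display) (X : measurableType dX).
Context (d m K : nat) (t lambda eta : R) (P : probability (X * X)%type R).
Context (phi : {mfun X >-> 'rV[R]_d}) (f : 'rV[R]_d -> 'rV[R]_m).
Hypothesis t_gt0 : 0 < t.
Hypothesis lambda_ge0 : 0 <= lambda.
Hypothesis eta01 : 0 <= eta <= 1.
Hypothesis f_lip : elipschitz f.
Hypothesis f_sphere : forall z, enorm (f z) = 1.

Let a : X * X -> R := similarity f t \o map_pair phi phi.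

Let measurable_a : measurable_fun setT a.
Proof. exact: measurableT_comp (measurable_similarity t f_lip) _. Qed.

Let a_ge0 w : 0 <= a w. Proof. exact: expR_ge0. Qed.

Let a_bounded w : `|a w| <= expR (1 / t).
Proof. by rewrite ger0_norm//; exact: similarity_le. Qed.

Local Notation negative i := (map_pair (@fst X X) (@draw _ X K i)).

Lemma rince_sample1 w : rince_sample t phi f lambda 1 w =
  lambda * (\sum_(i < K) a (negative i w)) - (1 - lambda) * a w.1.
Proof.
rewrite /rince_sample /rince !divr1 mul1r powRr1; last first.
  by rewrite mulr_ge0// addr_ge0 ?expR_ge0//; apply: sumr_ge0 => i _;
    exact: expR_ge0.
have -> : expR (score t phi f w.1.1 w.1.2) = a w.1 by [].
set S := \sum_(i < K) _. ring.
Qed.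

Lemma expectation_rince1 (p r : R) :
  (\int[P]_w (a w)%:E = p%:E)%E ->
  (\int[margX P \x margV P]_w (a w)%:E = r%:E)%E ->
  ('E_(noisy_joint P eta01 \x iid_law (margV P) K)
     [rince_sample t phi f lambda 1] =
   (lambda * (K%:R * r) - (1 - lambda) * ((1 - eta) * p + eta * r))%:E)%E.
Proof.
move=> Pp Pr.
have maE : measurable_fun setT (EFin \o a) by exact/measurable_EFinP.
have aE0 w : (0 <= (EFin \o a) w)%E by rewrite lee_fin.
set Q := (noisy_joint P eta01 \x iid_law (margV P) K)%E.
have int_pos : (\int[Q]_w (a w.1)%:E = ((1 - eta) * p + eta * r)%:E)%E.
  rewrite [LHS](@ge0_integral_law _ _ _ _ _ Q (noisy_joint P eta01) fst
    (EFin \o a))//.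
    by rewrite ge0_integral_mixture//= Pp Pr.
  by move=> A mA; exact: product_law_fst.
(* The map [negative i] acts separately on the two independent factors, so the pair of anchor and
   negative has the product of the marginals as its law. *)
have int_neg i : (\int[Q]_w (a (negative i w))%:E = r%:E)%E.
  rewrite [LHS](@ge0_integral_law _ _ _ _ _ Q (margX P \x margV P)%E
    (negative i) (EFin \o a))//.
  move=> A mA.
  by apply: product_law => // B mB;
    [exact: noisy_joint_fst|exact: iid_law_draw].
(* The loss changes sign, so splitting its integral needs integrability, which comes from
   boundedness of the kernel. *)
have ipos : Q.-integrable setT (EFin \o (fun w => a w.1)).
  apply: (@probability_bounded_integrable _ _ _ Q _ (expR (1 / t))) => //.
  exact: (measurableT_comp measurable_a).
have ineg i : Q.-integrable setT (EFin \o (fun w => a (negative i w))).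
  apply: (@probability_bounded_integrable _ _ _ Q _ (expR (1 / t))) => //.
  exact: (measurableT_comp measurable_a).
have isum : Q.-integrable setT (fun w => \sum_(i < K) (a (negative i w))%:E)%E.
  by apply: integrable_sum => // i _; exact: ineg.
rewrite unlock.
under eq_integral do rewrite rince_sample1 EFinB !EFinM -sumEFin.
rewrite integralB//; [|exact: integrableZl|exact: integrableZl].
rewrite !integralZl// integral_sum// int_pos.
under eq_bigr do rewrite int_neg.
by rewrite sumEFin sumr_const card_ord mulr_natl -!EFinM -EFinB.
Qed.

End rince_expectation.

(** * Combining the expected loss with duality *)

Theorem mainTheorem4 (R : realType) (dX : measure_display)
    (X : measurableType dX) (d m K : nat) (t lambda eta : R)
    (P : probability (X * X)%type R)
    (phi : {mfun X >-> 'rV[R]_d}) (f : 'rV[R]_d -> 'rV[R]_m)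
    (K_ge1 : (1 <= K)%N) (t_gt0 : 0 < t)
    (lambda_gt0 : 0 < lambda) (lambda_le1 : lambda <= 1)
    (eta01 : 0 <= eta <= 1)
    (f_lip : elipschitz f) (f_sphere : forall z, enorm (f z) = 1)
    (lambda_ge : (eta * K%:R - eta + 1) / (eta * K%:R - eta + 1 + K%:R)
                 <= lambda) :
  (- 'E_(noisy_joint P eta01 \x iid_law (margV P) K)
       [rince_sample t phi f lambda 1]
   <= (1 - eta)%:E * (Lip f * (1 - lambda) * expR (1 / t) / t)%:E
      * wasserstein_dependency P phi)%E.

Proof.
have /andP[eta0 eta1] := eta01.
pose a := similarity f t \o map_pair phi phi.
have ma : measurable_fun setT a.
  exact: measurableT_comp (measurable_similarity t f_lip) _.
have mE : measurable_fun setT (EFin \o similarity f t).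
  by apply/measurable_EFinP; exact: measurable_similarity.
have a_fin (Q : probability (X * X)%type R) :
    (\int[Q]_w (a w)%:E)%E \is a fin_num.
  apply: integrable_fin_num => //.
  apply: (@probability_bounded_integrable _ _ _ Q _ (expR (1 / t))) => // w.
  by rewrite ger0_norm ?expR_ge0//; exact: similarity_le.
have := a_fin P; have := a_fin (margX P \x margV P)%E.
(* [r] and [p] are the kernel expectations under the product of the marginals and under [P], as real
   numbers. *)
set r_ := (X in X \is a _); move=> /fineK Er; set p_ := (X in X \is a _).
move=> /fineK Ep.
set r := fine r_ in Er; set p := fine p_ in Ep.
have r0 : 0 <= r.
  by apply: fine_ge0; apply: integral_ge0 => w _; rewrite lee_fin expR_ge0.
rewrite (@expectation_rince1 _ _ _ _ _ _ _ _ _ _ _ _ t_gt0 (ltW lambda_gt0)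
  eta01 f_lip f_sphere p r)//.
set W := wasserstein_dependency P phi.
set c := Lip f * expR (1 / t) / t.
have c0 : 0 <= c.
  by rewrite divr_ge0 ?(ltW t_gt0)// mulr_ge0 ?expR_ge0//; exact: Lip_ge0.
have prW : ((p - r)%:E <= c%:E * W)%E.
  have Emu : (\int[distribution P (map_pair phi phi)]_z (similarity f t z)%:E
      = p%:E)%E.
    rewrite Ep [LHS](ge0_integral_distribution (P := P) (map_pair phi phi) mE)//.
    by move=> z; rewrite lee_fin expR_ge0.
  have Enu : (\int[distribution (margX P) phi \x distribution (margV P) phi]_z
      (similarity f t z)%:E = r%:E)%E.
    rewrite Er; apply/esym.
    apply: (@ge0_integral_law _ _ _ _ _ (margX P \x margV P)%E _
      (map_pair phi phi) (EFin \o similarity f t)) => //.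
      exact: product_law.
    by move=> z; rewrite lee_fin expR_ge0.
  rewrite EFinB leeBlDl// -Emu -Enu; apply: wasserstein_dual => //.
  - exact: measurable_similarity.
  - by move=> z; exact: expR_ge0.
  - exact: similarity_lip.
  - by rewrite Enu.
(* With [D = 1 + eta * (K%:R - 1)], clearing the denominator gives
   [lambda * K%:R >= D * (1 - lambda)], and [D >= 1]. *)
have lambdaK : 1 <= lambda * (1 + K%:R).
  have K1 : (1 : R) <= K%:R by rewrite ler1n.
  have eK : 0 <= eta * (K%:R - 1) by rewrite mulr_ge0// subr_ge0.
  have : 0 <= eta * (K%:R - 1) * (1 - lambda) by rewrite mulr_ge0// subr_ge0.
  by move: lambda_ge; rewrite ler_pdivrMr; lra.
(* The right side exceeds the left by exactly [(lambda * (1 + K%:R) - 1) * r]. *)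
apply: (@le_trans _ _ (((1 - lambda) * (1 - eta))%:E * (p - r)%:E)%E).
  have : 0 <= (lambda * (1 + K%:R) - 1) * r by rewrite mulr_ge0// subr_ge0.
  by rewrite -EFinN -EFinM lee_fin; lra.
have -> : ((1 - eta)%:E * (Lip f * (1 - lambda) * expR (1 / t) / t)%:E * W =
    ((1 - lambda) * (1 - eta))%:E * (c%:E * W))%E.
  by rewrite muleA -!EFinM /c; congr (_%:E * _)%E; ring.
by apply: lee_wpmul2l => //; rewrite lee_fin mulr_ge0 ?subr_ge0.
Qed.
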